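(* Let $L\subset\mathbb{Z}^n$ be a lattice and $S=\{B_1,\ldots,B_t\}$ a minimal generating set of $I_L$. The multiset $\{\overline{F_{B_i}}: F_{B_i}\notin\overline F_{\{1\}}\}$ is an invariant of $I_L$; that is, it is the same multiset for every minimal generating set $S$ of $I_L$.
   Context: Let $\Bbbk$ be a field, $\mathbb{N}=\mathbb{Z}_{\ge0}$. A lattice is a subgroup $L\subset\mathbb{Z}^n$; its lattice ideal is $I_L=\langle x^u-x^v:u,v\in\mathbb{N}^n,\ u-v\in L\rangle\subset\Bbbk[x_1,\ldots,x_n]$. A binomial means a difference $x^u-x^v$ of two distinct monomials. A minimal generating set of $I_L$ is a set of binomials that is a minimal (under inclusion, not necessarily of least cardinality) system of generators of $I_L$. An $I_L$-fiber is a set of the form $F_u=\{x^v:v\in\mathbb{N}^n,\ v-u\in L\}$ with $u\in\mathbb{N}^n$. For a binomial $B=x^u-x^v\in I_L$, $F_B:=F_u=F_v$. $F_{\{1\}}$ is the fiber containing $1$. Fibers $F,G$ are equivalent if there are $u,v\in\mathbb{N}^n$ with $x^uF\subset G$ and $x^vG\subset F$; $\overline F$ denotes the equivalence class of $F$. The multiset in question has one entry $\overline{F_{B_i}}$ for each index $i$ with $F_{B_i}\notin\overline F_{\{1\}}$. *)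

(* Defs.v *)
From HB Require Import structures.
From mathcomp Require Import all_boot all_order all_algebra.
From mathcomp Require Import finmap multiset mpoly.
From mathcomp Require Import boolp classical_sets.

Set Implicit Arguments.
Unset Strict Implicit.
Unset Printing Implicit Defensive.

Import GRing.Theory.

Local Open Scope fset_scope.
Local Open Scope mset_scope.
Local Open Scope classical_set_scope.
Local Open Scope ring_scope.

Definition ideal_span (R : comNzRingType) (G : set R) : set R :=
  [set p | exists r : seq (R * R),
     (forall c, c \in r -> G c.2) /\ p = \sum_(c <- r) c.1 * c.2].

Definition mnm_diff (n : nat) (u v : 'X_{1..n}) : 'rV[int]_n :=
  \row_(i < n) ((u i)%:Z - (v i)%:Z).

Definition lattice_ideal (k : fieldType) (n : nat) (L : zmodClosed 'rV[int]_n) :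
    set {mpoly k[n]} :=
  ideal_span [set p | exists u v : 'X_{1..n},
    mnm_diff u v \in L /\ p = 'X_[u] - 'X_[v]].

Definition is_binomial (k : fieldType) (n : nat) (B : {mpoly k[n]}) : Prop :=
  exists u v : 'X_{1..n}, u <> v /\ B = 'X_[u] - 'X_[v].

Definition minimal_generating_set (k : fieldType) (n : nat)
    (L : zmodClosed 'rV[int]_n) (S : {fset {mpoly k[n]}}) : Prop :=
  [/\ forall B, B \in S -> is_binomial B,
      ideal_span [set` S] = lattice_ideal L
    & forall T : {fset {mpoly k[n]}},
        (T `<` S)%fset -> ideal_span [set` T] <> lattice_ideal L].

(* Monomials are identified with their exponents, so a set of monomials is a
   [set 'X_{1..n}] and multiplication by [x^u] is translation by [u]. *)
Definition fiber (n : nat) (L : zmodClosed 'rV[int]_n) (u : 'X_{1..n}) :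
    set 'X_{1..n} :=
  [set v | mnm_diff v u \in L].

(* A binomial may be written [x^u - x^v] in two ways in characteristic 2; for
   [B] in the lattice ideal of [L] the fibers of [u] and [v] coincide, so the
   set below is that common fiber. *)
Definition binomial_fiber (k : fieldType) (n : nat) (L : zmodClosed 'rV[int]_n)
    (B : {mpoly k[n]}) : set 'X_{1..n} :=
  [set w | exists u v : 'X_{1..n},
    [/\ u <> v, B = 'X_[u] - 'X_[v] & fiber L u w]].

Definition fiber_equiv (n : nat) (F G : set 'X_{1..n}) : Prop :=
  exists u v : 'X_{1..n},
    [set (u + w)%MM | w in F] `<=` G /\ [set (v + w)%MM | w in G] `<=` F.

Definition fiber_class (n : nat) (L : zmodClosed 'rV[int]_n)
    (F : set 'X_{1..n}) : set (set 'X_{1..n}) :=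
  [set G | range (fiber L) G /\ fiber_equiv F G].

Definition fiber_class_mset (k : fieldType) (n : nat)
    (L : zmodClosed 'rV[int]_n) (S : {fset {mpoly k[n]}}) :
    {mset set (set 'X_{1..n})} :=
  seq_mset [seq fiber_class L (binomial_fiber L B) |
            B <- enum_fset S &
            binomial_fiber L B \notin fiber_class L (fiber L 0%MM)].

(* Main.v *)
Require Import Defs.
From mathcomp Require Import all_boot all_order all_algebra.
From mathcomp Require Import finmap multiset mpoly.
From mathcomp Require Import boolp classical_sets.

Set Implicit Arguments.
Unset Strict Implicit.
Unset Printing Implicit Defensive.

Import GRing.Theory.

Local Open Scope classical_set_scope.
Local Open Scope ring_scope.

(** The polynomial ring is graded by the fibers, because congruence of exponents
modulo [L] is compatible with addition, and the lattice ideal [I] is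
homogeneous for this grading.  Preorder the fibers by [F_u <= F_w] when some
monomial carries [F_u] into [F_w]; its equivalence classes are the classes of
the statement, and [F_0] is a least fiber.

Fix a fiber [F_w] that is not equivalent to [F_0], and let [J] be the ideal
spanned by the binomials of [I] whose fiber does not lie above [F_w]
([not_above_ideal]).  It does not depend on a generating set.  The number of
elements of a minimal generating set [S] with fiber equivalent to [F_w] is the
dimension of [I] in degree [w] modulo [J].  Indeed, multiply each such [B] by a
monomial [x^(lift B)] that carries its fiber into [F_w].

- The lifted elements span ([lifted_generators_span]).  An element of [I] of
  degree [w] is a combination of terms [x^m B] of degree [w] with [B] in [S],
  since [S] consists of homogeneous elements.  If [F_B] is not above [F_w],
  then [B] is in [J].  Otherwise [B] is in the class, and [x^m B] agrees with
  [x^(lift B) B] modulo [J]: the binomial [x^m - x^(lift B)] is in [J], because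
  a fiber [F_m] above [F_w] would force [F_w <= F_0].
- The lifted elements are independent modulo [J]
  ([lifted_generators_independent]).  For [B0] in the class, [J] lies in the
  ideal spanned by [S] without [B0] ([not_above_ideal_avoids]).  A relation with
  a nonzero coefficient at [B0] therefore puts [x^(lift B0) B0] in that ideal.
  Multiplying by a monomial [x^b] that carries [F_w] back into [F_B0] gives
  [x^(b + lift B0) B0], which agrees with [B0] modulo [J] because
  [x^(b + lift B0) - 1] is in [J]: this is where [F_w] must not be equivalent
  to [F_0].  So [B0] is redundant, against minimality.

Two minimal generating sets thus have equally many elements in the class, which
is the equality of the multiplicities in the two multisets. *)

(** * Ideals spanned by a set *)

Lemma ideal_span0 (R : comNzRingType) (G : set R) : ideal_span G 0.
Proof. by exists [::]; split=> //; rewrite big_nil. Qed.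

Lemma ideal_spanD (R : comNzRingType) (G : set R) (p q : R) :
  ideal_span G p -> ideal_span G q -> ideal_span G (p + q).
Proof.
move=> [r [Gr ->]] [s [Gs ->]]; exists (r ++ s); rewrite big_cat; split=> // c.
by rewrite mem_cat => /orP[/Gr|/Gs].
Qed.

Lemma ideal_spanM (R : comNzRingType) (G : set R) (a p : R) :
  ideal_span G p -> ideal_span G (a * p).
Proof.
move=> [r [Gr ->]]; exists [seq (a * c.1, c.2) | c <- r]; split.
  by move=> _ /mapP[c /Gr Gc ->].
by rewrite big_map mulr_sumr; apply: eq_bigr => c _; rewrite mulrA.
Qed.

Lemma ideal_span_gen (R : comNzRingType) (G : set R) (g : R) :
  G g -> ideal_span G g.
Proof.
move=> Gg; exists [:: (1, g)]; rewrite big_seq1 mul1r; split=> // c.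
by rewrite inE => /eqP ->.
Qed.

Lemma ideal_spanN (R : comNzRingType) (G : set R) (p : R) :
  ideal_span G p -> ideal_span G (- p).
Proof. by move=> Gp; rewrite -mulN1r; apply: ideal_spanM. Qed.

Lemma ideal_spanZ (k : fieldType) (n : nat) (G : set {mpoly k[n]})
    (c : k) (p : {mpoly k[n]}) :
  ideal_span G p -> ideal_span G (c *: p).
Proof. by move=> Gp; rewrite -mul_mpolyC; apply: ideal_spanM. Qed.

Lemma ideal_span_sum (R : comNzRingType) (G : set R) (I : eqType) (r : seq I)
    (P : pred I) (F : I -> R) :
  (forall i, i \in r -> P i -> ideal_span G (F i)) ->
  ideal_span G (\sum_(i <- r | P i) F i).
Proof.
move=> GF; rewrite big_seq_cond; apply: big_ind => [|p q|i /andP[]].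
- exact: ideal_span0.
- exact: ideal_spanD.
- exact: GF.
Qed.

Lemma ideal_span_ind (R : comNzRingType) (G K : set R) :
  K 0 -> (forall p q, K p -> K q -> K (p + q)) ->
  (forall a g, G g -> K (a * g)) -> ideal_span G `<=` K.
Proof.
move=> K0 KD KM _ [r [Gr ->]]; rewrite big_seq; apply: big_ind => // c /Gr.
exact: KM.
Qed.

Lemma ideal_span_sub (R : comNzRingType) (G H : set R) :
  G `<=` ideal_span H -> ideal_span G `<=` ideal_span H.
Proof.
move=> GH; apply: ideal_span_ind => [|p q|a g /GH].
- exact: ideal_span0.
- exact: ideal_spanD.
- exact: ideal_spanM.
Qed.

(** * Congruence of exponents modulo the lattice *)

Definition congruent (n : nat) (L : zmodClosed 'rV[int]_n) (u v : 'X_{1..n}) :=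
  mnm_diff u v \in L.

Lemma congruent_refl (n : nat) (L : zmodClosed 'rV[int]_n) (u : 'X_{1..n}) :
  congruent L u u.
Proof.
rewrite /congruent; have -> : mnm_diff u u = 0; last exact: rpred0.
by apply/rowP=> i; rewrite !mxE subrr.
Qed.

Lemma congruent_sym (n : nat) (L : zmodClosed 'rV[int]_n) (u v : 'X_{1..n}) :
  congruent L u v = congruent L v u.
Proof.
rewrite /congruent; have -> : mnm_diff u v = - mnm_diff v u; last exact: rpredN.
by apply/rowP=> i; rewrite !mxE opprB.
Qed.

Lemma congruent_trans (n : nat) (L : zmodClosed 'rV[int]_n)
    (v u w : 'X_{1..n}) :
  congruent L u v -> congruent L v w -> congruent L u w.
Proof.
rewrite /congruent => uv vw.
have -> : mnm_diff u w = mnm_diff u v + mnm_diff v w; last exact: rpredD.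
by apply/rowP=> i; rewrite !mxE addrA subrK.
Qed.

Lemma congruent_add2l (n : nat) (L : zmodClosed 'rV[int]_n)
    (m u v : 'X_{1..n}) :
  congruent L (m + u)%MM (m + v)%MM = congruent L u v.
Proof.
rewrite /congruent; set d := mnm_diff u v.
suff -> : mnm_diff (m + u)%MM (m + v)%MM = d by [].
apply/rowP=> i; rewrite !mxE !mnmDE.
by rewrite !PoszD opprD addrACA subrr add0r.
Qed.

Lemma congruent_left (n : nat) (L : zmodClosed 'rV[int]_n)
    (u v w : 'X_{1..n}) :
  congruent L u v -> congruent L u w = congruent L v w.
Proof.
move=> uv; apply/idP/idP; last exact: (congruent_trans uv).
by apply: (@congruent_trans _ _ u); rewrite congruent_sym.
Qed.

Definition fiber_le (n : nat) (L : zmodClosed 'rV[int]_n) (u v : 'X_{1..n}) :=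
  exists a : 'X_{1..n}, congruent L (a + u)%MM v.

Lemma fiber_le_cong (n : nat) (L : zmodClosed 'rV[int]_n)
    (u v w : 'X_{1..n}) :
  congruent L v w -> fiber_le L u v -> fiber_le L u w.
Proof. by move=> vw [a auv]; exists a; apply: congruent_trans vw. Qed.

Lemma fiber_le_trans (n : nat) (L : zmodClosed 'rV[int]_n)
    (v u w : 'X_{1..n}) :
  fiber_le L u v -> fiber_le L v w -> fiber_le L u w.
Proof.
move=> [a auv] [b bvw]; exists (b + a)%MM; rewrite -addmA.
by apply: congruent_trans bvw; rewrite congruent_add2l.
Qed.

(** * The grading of the polynomial ring by fibers *)

Definition homogeneous (k : fieldType) (n : nat) (L : zmodClosed 'rV[int]_n)
    (u : 'X_{1..n}) (p : {mpoly k[n]}) : Prop :=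
  forall m, p@_m != 0 -> congruent L m u.

Definition fiber_part (k : fieldType) (n : nat) (L : zmodClosed 'rV[int]_n)
    (u : 'X_{1..n}) (p : {mpoly k[n]}) : {mpoly k[n]} :=
  \sum_(m <- msupp p | congruent L m u) p@_m *: 'X_[m].

Lemma mcoeff_fiber_part (k : fieldType) (n : nat) (L : zmodClosed 'rV[int]_n)
    (u : 'X_{1..n}) (p : {mpoly k[n]}) (m : 'X_{1..n}) :
  (fiber_part L u p)@_m = if congruent L m u then p@_m else 0.
Proof.
rewrite /fiber_part raddf_sum /=.
under eq_bigr do rewrite mcoeffZ mcoeffX.
have [mp|/memN_msupp_eq0 pm0] := boolP (m \in msupp p); last first.
  rewrite pm0 if_same big1 // => m' _.
  by case: eqP => [->|_]; rewrite ?pm0 ?mul0r ?mulr0.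
rewrite big_mkcond (bigD1_seq m) ?msupp_uniq //= eqxx mulr1 big1 ?addr0 //.
by move=> m' /negbTE ->; rewrite mulr0 if_same.
Qed.

Lemma fiber_partD (k : fieldType) (n : nat) (L : zmodClosed 'rV[int]_n)
    (u : 'X_{1..n}) (p q : {mpoly k[n]}) :
  fiber_part L u (p + q) = fiber_part L u p + fiber_part L u q.
Proof.
apply/mpolyP=> m; rewrite mcoeffD !mcoeff_fiber_part mcoeffD.
by case: ifP => // _; rewrite addr0.
Qed.

Lemma fiber_part0 (k : fieldType) (n : nat) (L : zmodClosed 'rV[int]_n)
    (u : 'X_{1..n}) :
  fiber_part L u (0 : {mpoly k[n]}) = 0.
Proof. by apply/mpolyP=> m; rewrite mcoeff_fiber_part mcoeff0 if_same. Qed.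

Lemma fiber_part_id (k : fieldType) (n : nat) (L : zmodClosed 'rV[int]_n)
    (u : 'X_{1..n}) (p : {mpoly k[n]}) :
  homogeneous L u p -> fiber_part L u p = p.
Proof.
move=> hp; apply/mpolyP=> m; rewrite mcoeff_fiber_part.
by have [->|/hp ->] := eqVneq p@_m 0; rewrite ?if_same.
Qed.

Lemma fiber_part_eq0 (k : fieldType) (n : nat) (L : zmodClosed 'rV[int]_n)
    (u a : 'X_{1..n}) (p : {mpoly k[n]}) :
  homogeneous L a p -> ~~ congruent L a u -> fiber_part L u p = 0.
Proof.
move=> hp au; apply/mpolyP=> m; rewrite mcoeff_fiber_part mcoeff0.
case: ifP => // mu; apply/eqP; apply: contraNT au => /hp ma.
by rewrite -(congruent_left _ ma).
Qed.

Lemma homogeneous_unique (k : fieldType) (n : nat) (L : zmodClosed 'rV[int]_n)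
    (u v : 'X_{1..n}) (p : {mpoly k[n]}) :
  p != 0 -> homogeneous L u p -> homogeneous L v p -> congruent L u v.
Proof.
move=> p0 hu hv; apply: contraNT p0 => uv.
by rewrite -(fiber_part_id hv) (fiber_part_eq0 hu uv).
Qed.

Lemma homogeneous_cong (k : fieldType) (n : nat) (L : zmodClosed 'rV[int]_n)
    (u v : 'X_{1..n}) (p : {mpoly k[n]}) :
  congruent L u v -> homogeneous L u p -> homogeneous L v p.
Proof. by move=> uv hu m /hu mu; apply: congruent_trans uv. Qed.

Lemma homogeneousZ (k : fieldType) (n : nat) (L : zmodClosed 'rV[int]_n)
    (u : 'X_{1..n}) (c : k) (p : {mpoly k[n]}) :
  homogeneous L u p -> homogeneous L u (c *: p).
Proof.
by move=> hu m; rewrite mcoeffZ mulf_eq0 negb_or => /andP[_ /hu].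
Qed.

Lemma homogeneousMX (k : fieldType) (n : nat) (L : zmodClosed 'rV[int]_n)
    (u a : 'X_{1..n}) (p : {mpoly k[n]}) :
  homogeneous L u p -> homogeneous L (a + u)%MM ('X_[a] * p).
Proof.
move=> hu m; rewrite mulrC -mcoeff_msupp (perm_mem (msuppMX _ _)).
by case/mapP=> v; rewrite mcoeff_msupp => /hu vu ->; rewrite congruent_add2l.
Qed.

Lemma homogeneous_binomial (k : fieldType) (n : nat)
    (L : zmodClosed 'rV[int]_n) (u v : 'X_{1..n}) :
  congruent L u v -> homogeneous L u ('X_[u] - 'X_[v] : {mpoly k[n]}).
Proof.
move=> uv m; rewrite mcoeffB !mcoeffX.
have [<- _|_] := eqVneq u m; first exact: congruent_refl.
have [<- _|_] := eqVneq v m; first by rewrite congruent_sym.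
by rewrite subrr eqxx.
Qed.

(** Homogeneous generators suffice in each degree: expanding the coefficients
into monomials, the terms of the wrong degree disappear in the projection.  So
an additive property of the degree [u] part of an ideal need only be checked on
the monomial multiples of generators that have degree [u]. *)
Lemma fiber_part_span (k : fieldType) (n : nat) (L : zmodClosed 'rV[int]_n)
    (u : 'X_{1..n}) (G K : set {mpoly k[n]}) :
  (forall g, G g -> exists a, homogeneous L a g) ->
  K 0 -> (forall p q, K p -> K q -> K (p + q)) ->
  (forall c m a g, G g -> homogeneous L a g -> congruent L (m + a)%MM u ->
     K (c *: ('X_[m] * g))) ->
  forall p, ideal_span G p -> K (fiber_part L u p).
Proof.
move=> hG K0 KD KM; apply: ideal_span_ind => [|p q Kp Kq|f g Gg].
- by rewrite fiber_part0.
- by rewrite fiber_partD; apply: KD.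
rewrite (mpolyE f) mulr_suml.
apply: (big_ind (fun q => K (fiber_part L u q))) => [|p q Kp Kq|m _].
- by rewrite fiber_part0.
- by rewrite fiber_partD; apply: KD.
have [a ha] := hG _ Gg; rewrite -scalerAl.
have hmg : homogeneous L (m + a)%MM (f@_m *: ('X_[m] * g)).
  exact/homogeneousZ/homogeneousMX.
have [mau|mau] := boolP (congruent L (m + a)%MM u).
  by rewrite (fiber_part_id (homogeneous_cong mau hmg)); apply: KM mau.
by rewrite (fiber_part_eq0 hmg mau).
Qed.

(** * Binomials of the lattice ideal *)

Definition lattice_binomial (k : fieldType) (n : nat)
    (L : zmodClosed 'rV[int]_n) (B : {mpoly k[n]}) : Prop :=
  exists u v : 'X_{1..n},
    [/\ u <> v, congruent L u v & B = 'X_[u] - 'X_[v]].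

Lemma binomial_neq0 (k : fieldType) (n : nat) (u v : 'X_{1..n}) :
  u <> v -> 'X_[u] - 'X_[v] != 0 :> {mpoly k[n]}.
Proof.
move=> /eqP uv; apply/eqP=> /mpolyP /(_ u) /eqP.
rewrite mcoeffB !mcoeffX eqxx mcoeff0 [v == u]eq_sym (negbTE uv) subr0.
by rewrite oner_eq0.
Qed.

Lemma lattice_binomial_neq0 (k : fieldType) (n : nat)
    (L : zmodClosed 'rV[int]_n) (B : {mpoly k[n]}) :
  lattice_binomial L B -> B != 0.
Proof. by move=> [u [v [uv _ ->]]]; apply: binomial_neq0. Qed.

(** The sum of the coefficients over the fiber of [u] vanishes on all monomial
multiples of the generators, hence on the whole ideal; if [v] were in another
fiber, it would be 1 on [x^u - x^v]. *)
Lemma lattice_ideal_binomial (k : fieldType) (n : nat)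
    (L : zmodClosed 'rV[int]_n) (u v : 'X_{1..n}) :
  lattice_ideal L ('X_[u] - 'X_[v] : {mpoly k[n]}) -> congruent L u v.
Proof.
move=> uvI; have [->|/eqP uv] := eqVneq u v; first exact: congruent_refl.
(* Evaluation at the point with all coordinates 1 sums the coefficients. *)
pose one_ (i : 'I_n) : k := 1.
have one_X m : 'X_[m].@[one_] = 1.
  by rewrite mevalX big1 // => i _; rewrite expr1n.
have Hspan : (fiber_part L u ('X_[u] - 'X_[v])).@[one_] = 0.
  apply: (fiber_part_span (K := [set q | q.@[one_] = 0])) uvI => /=.
  - move=> _ [a [b [ab ->]]]; exists a; exact: homogeneous_binomial.
  - by rewrite meval0.
  - by move=> p q p0 q0; rewrite mevalD p0 q0 addr0.
  - move=> c m _ _ [a [b [_ ->]]] _ _.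
    by rewrite mevalZ mevalM mevalB !one_X subrr mulr0 mulr0.
apply: contra_eqT Hspan => uv'.
have -> : fiber_part L u ('X_[u] - 'X_[v]) = 'X_[u] :> {mpoly k[n]}.
  apply/mpolyP=> m; rewrite mcoeff_fiber_part mcoeffB !mcoeffX.
  have [<-|um] := eqVneq u m.
    by rewrite congruent_refl [v == u]eq_sym (introF eqP uv) subr0.
  have [<-|_] := eqVneq v m; last by rewrite subrr if_same.
  by rewrite congruent_sym (negbTE uv').
by rewrite one_X oner_eq0.
Qed.

(** A binomial can be written in two ways in characteristic 2; both give the
same fiber because a nonzero polynomial has only one degree. *)
Lemma binomial_fiberE (k : fieldType) (n : nat) (L : zmodClosed 'rV[int]_n)
    (a : 'X_{1..n}) (B : {mpoly k[n]}) :
  lattice_binomial L B -> homogeneous L a B -> binomial_fiber L B = fiber L a.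
Proof.
move=> LB ha; have B0 := lattice_binomial_neq0 LB.
have [u0 [v0 [uv0 congr_uv0 BE]]] := LB.
have fiberE u v : B = 'X_[u] - 'X_[v] -> congruent L u a.
  move=> Buv; apply: (homogeneous_unique B0) ha.
  rewrite Buv; apply: homogeneous_binomial.
  apply: (@lattice_ideal_binomial k); rewrite -Buv BE.
  by apply: ideal_span_gen; exists u0, v0.
apply/seteqP; split=> w /=.
  by move=> [u [v [_ Buv wu]]]; apply: congruent_trans (fiberE _ _ Buv).
move=> wa; exists u0, v0; split=> //; apply: congruent_trans wa _.
by rewrite congruent_sym (fiberE _ _ BE).
Qed.

(** * Linear algebra modulo a subspace *)

(** Elements of [s] independent modulo [J] and expressed through [t], which is
in turn expressed through [s], give transition matrices with product the
identity, of size [size s] and factoring through [size t].  This replaces the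
dimension of the quotient by [J] and avoids forming a quotient space. *)
Lemma size_independent_le (k : fieldType) (V : lmodType k) (X : eqType)
    (J : set V) (s t : seq X) (f g : X -> V) :
  J 0 -> (forall p q, J p -> J q -> J (p + q)) ->
  (forall c p, J p -> J (c *: p)) -> uniq s ->
  (forall x, x \in s -> exists c : X -> k,
     J (f x - \sum_(y <- t) c y *: g y)) ->
  (forall y, y \in t -> exists c : X -> k,
     J (g y - \sum_(x <- s) c x *: f x)) ->
  (forall c : X -> k, J (\sum_(x <- s) c x *: f x) ->
     forall x, x \in s -> c x = 0) ->
  (size s <= size t)%N.
Proof.
move=> J0 JD JZ s_uniq s_span t_span s_free.
have /choice[P HP] : forall x, exists c : X -> k, x \in s ->
    J (f x - \sum_(y <- t) c y *: g y).
  move=> x; have [/s_span[c Hc]|_] := boolP (x \in s); first by exists c.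
  by exists (fun=> 0).
have /choice[Q HQ] : forall y, exists c : X -> k, y \in t ->
    J (g y - \sum_(x <- s) c x *: f x).
  move=> y; have [/t_span[c Hc]|_] := boolP (y \in t); first by exists c.
  by exists (fun=> 0).
have PQ x z : x \in s -> z \in s ->
    \sum_(y <- t) P x y * Q y z = (x == z)%:R.
  move=> xs zs; apply/esym/eqP; rewrite -subr_eq0; apply/eqP.
  (* Expressing [f x] through [t], then back through [s], is a relation
     modulo [J]. *)
  pose c z := (x == z)%:R - \sum_(y <- t) P x y * Q y z.
  apply: (s_free c) zs.
  have -> : \sum_(z <- s) c z *: f z =
      (f x - \sum_(y <- t) P x y *: g y) +
      \sum_(y <- t) P x y *: (g y - \sum_(z <- s) Q y z *: f z).
    have -> : \sum_(y <- t) P x y *: (g y - \sum_(z <- s) Q y z *: f z) =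
        \sum_(y <- t) P x y *: g y -
        \sum_(z <- s) (\sum_(y <- t) P x y * Q y z) *: f z.
      under eq_bigr do rewrite scalerBr scaler_sumr.
      rewrite sumrB exchange_big; congr (_ - _); apply: eq_bigr => w _.
      by rewrite scaler_suml; apply: eq_bigr => y _; rewrite scalerA.
    rewrite addrA subrK; under eq_bigr do rewrite scalerBl.
    rewrite sumrB; congr (_ - _).
    rewrite (bigD1_seq x) //= eqxx scale1r big1 ?addr0 // => w.
    by rewrite eq_sym => /negbTE ->; rewrite scale0r.
  apply: (JD _ _ (HP _ xs)); rewrite big_seq; apply: big_ind => [//|p q|y yt].
    exact: JD.
  exact/JZ/HQ.
pose A := \matrix_(i < size s, j < size t)
  P (tnth (in_tuple s) i) (tnth (in_tuple t) j).
pose B := \matrix_(j < size t, i < size s)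
  Q (tnth (in_tuple t) j) (tnth (in_tuple s) i).
apply: (@mulmx1_min k _ _ A B); apply/matrixP=> i i'; rewrite !mxE.
under eq_bigr do rewrite !mxE.
rewrite -(big_tnth _ _ t xpredT
  (fun y => P (tnth (in_tuple s) i) y * Q y (tnth (in_tuple s) i'))).
rewrite PQ ?mem_tnth // /=.
by rewrite (inj_eq (tuple_uniqP (in_tuple s) s_uniq)).
Qed.

(** * Generators in one equivalence class of fibers *)

(** The condition is that [F_u] is not above [F_w], rather than that it is
strictly below.  In degree [w] this makes no difference, as all monomial
multiples of degree [w] come from fibers below [F_w]. *)
Definition not_above_ideal (k : fieldType) (n : nat) (L : zmodClosed 'rV[int]_n)
    (w : 'X_{1..n}) : set {mpoly k[n]} :=
  ideal_span [set p | exists u v : 'X_{1..n},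
    [/\ congruent L u v, ~ fiber_le L w u & p = 'X_[u] - 'X_[v]]].

Lemma lattice_binomial_homogeneous (k : fieldType) (n : nat)
    (L : zmodClosed 'rV[int]_n) (B : {mpoly k[n]}) :
  lattice_binomial L B -> exists a, homogeneous L a B.
Proof.
by move=> [u [v [_ uv ->]]]; exists u; apply: homogeneous_binomial.
Qed.

Lemma minimal_generator_lattice_binomial (k : fieldType) (n : nat)
    (L : zmodClosed 'rV[int]_n) (S : {fset {mpoly k[n]}}) (B : {mpoly k[n]}) :
  minimal_generating_set L S -> B \in S -> lattice_binomial L B.
Proof.
move=> [S_bin S_gen _] BS; have [u [v [uv BE]]] := S_bin _ BS.
exists u, v; split=> //; apply: (@lattice_ideal_binomial k).
by rewrite -BE -S_gen; apply: ideal_span_gen.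
Qed.

(** Writing [x^u - x^v] through [S] within its own degree only uses elements
whose fiber is below [F_u]; one whose fiber is above [F_w] would put [F_u]
above [F_w]. *)
Lemma not_above_ideal_avoids (k : fieldType) (n : nat)
    (L : zmodClosed 'rV[int]_n) (w a0 : 'X_{1..n})
    (S : {fset {mpoly k[n]}}) (B0 : {mpoly k[n]}) :
  (forall B, B \in S -> lattice_binomial L B) ->
  ideal_span [set` S] = lattice_ideal L ->
  B0 \in S -> homogeneous L a0 B0 -> fiber_le L w a0 ->
  not_above_ideal L w `<=` ideal_span [set` (S `\ B0)%fset].
Proof.
move=> S_bin S_gen B0S hB0 wa0; apply: ideal_span_sub => _ [u [v [uv wu ->]]].
have : ideal_span [set` S] ('X_[u] - 'X_[v]).
  by rewrite S_gen; apply: ideal_span_gen; exists u, v.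
rewrite -[X in _ -> _ X](fiber_part_id (homogeneous_binomial uv)).
apply: fiber_part_span => [g /S_bin||p q|c m a g gS hg mau].
- exact: lattice_binomial_homogeneous.
- exact: ideal_span0.
- exact: ideal_spanD.
apply/ideal_spanZ/ideal_spanM/ideal_span_gen => /=.
rewrite !inE gS andbT; apply/eqP=> gB0; apply: wu.
have aa0 : congruent L a0 a.
  apply: homogeneous_unique hB0 _; rewrite -?gB0 //.
  exact/lattice_binomial_neq0/S_bin.
by apply: fiber_le_trans (fiber_le_cong aa0 wa0) _; exists m.
Qed.

(** A nonzero coefficient at [B0] would make [B0] redundant: the monomial that
takes [x^(lift B0) B0] back to the fiber of [B0] acts as the identity modulo
[not_above_ideal]. *)
Lemma lifted_generators_independent (k : fieldType) (n : nat)
    (L : zmodClosed 'rV[int]_n) (w : 'X_{1..n}) (S : {fset {mpoly k[n]}})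
    (T : seq {mpoly k[n]}) (lift : {mpoly k[n]} -> 'X_{1..n})
    (c : {mpoly k[n]} -> k) :
  minimal_generating_set L S -> ~ fiber_le L w 0%MM -> uniq T ->
  {subset T <= S} ->
  (forall B, B \in T -> exists a, [/\ homogeneous L a B,
     congruent L (lift B + a)%MM w & fiber_le L w a]) ->
  not_above_ideal L w (\sum_(B <- T) c B *: ('X_[lift B] * B)) ->
  forall B, B \in T -> c B = 0.
Proof.
move=> minS w0 T_uniq TS liftP Tsum B0 B0T.
have [_ S_gen S_min] := minS.
apply/eqP/negPn/negP=> cB0.
have [a0 [hB0 lift0 wa0]] := liftP _ B0T; have B0S := TS _ B0T.
have S_bin B : B \in S -> lattice_binomial L B.
  exact: minimal_generator_lattice_binomial.
have sub := not_above_ideal_avoids S_bin S_gen B0S hB0 wa0.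
pose I' := ideal_span [set` (S `\ B0)%fset].
have lift_in : I' ('X_[lift B0] * B0).
  move: Tsum => /sub; rewrite (bigD1_seq B0) //= => sum_in.
  have rest : I' (\sum_(B <- T | B != B0) c B *: ('X_[lift B] * B)).
    apply: ideal_span_sum => B BT BB0.
    apply/ideal_spanZ/ideal_spanM/ideal_span_gen => /=.
    by rewrite !inE BB0 TS.
  have /(ideal_spanZ (c B0)^-1) := ideal_spanD sum_in (ideal_spanN rest).
  by rewrite addrK scalerA mulVf // scale1r.
have [b wba0] := wa0.
have B0_in : I' B0.
  (* Translation by [b + lift B0] maps the fiber of [B0] to itself, so that
     exponent is congruent to 0. *)
  have unit_in : I' ('X_[b + lift B0] - 'X_[0]).
    apply/sub/ideal_span_gen; exists (b + lift B0)%MM, 0%MM.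
    have bl0 : congruent L (b + lift B0)%MM 0%MM.
      rewrite -(congruent_add2l _ a0) addm0 addmC -addmA.
      by apply: congruent_trans wba0; rewrite congruent_add2l.
    by split=> // /(fiber_le_cong bl0).
  have := ideal_spanD (ideal_spanM 'X_[b] lift_in)
                      (ideal_spanN (ideal_spanM B0 unit_in)).
  by rewrite mulrA -mpolyXD mulrBr mpolyX0 mulr1 mulrC opprB addrC subrK.
apply: (S_min (S `\ B0)%fset); first exact: fproperD1.
rewrite -S_gen; apply/seteqP; split; apply: ideal_span_sub => B /=.
  by rewrite !inE => /andP[_ BS]; apply: ideal_span_gen.
have [-> _|BB0 BS] := eqVneq B B0; first exact: B0_in.
by apply: ideal_span_gen; rewrite /= !inE BB0.
Qed.

(** Terms whose generator is not above [F_w] are absorbed by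
[not_above_ideal], and for the others the choice of the lifting monomial is
immaterial modulo that ideal. *)
Lemma lifted_generators_span (k : fieldType) (n : nat)
    (L : zmodClosed 'rV[int]_n) (w : 'X_{1..n}) (S : {fset {mpoly k[n]}})
    (T : seq {mpoly k[n]}) (lift : {mpoly k[n]} -> 'X_{1..n})
    (p : {mpoly k[n]}) :
  ideal_span [set` S] = lattice_ideal L ->
  (forall B, B \in S -> lattice_binomial L B) ->
  ~ fiber_le L w 0%MM -> uniq T ->
  (forall B a, B \in S -> homogeneous L a B -> fiber_le L a w ->
     fiber_le L w a -> B \in T) ->
  (forall B, B \in T -> exists a, [/\ homogeneous L a B,
     congruent L (lift B + a)%MM w & fiber_le L w a]) ->
  homogeneous L w p -> lattice_ideal L p ->
  exists c : {mpoly k[n]} -> k,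
    not_above_ideal L w (p - \sum_(B <- T) c B *: ('X_[lift B] * B)).
Proof.
move=> S_gen S_bin w0 T_uniq S_T liftP hp; rewrite -S_gen => pS.
rewrite -(fiber_part_id hp) {hp}; move: p pS.
apply: (fiber_part_span (K := [set q | exists c : {mpoly k[n]} -> k,
  not_above_ideal L w (q - \sum_(B <- T) c B *: ('X_[lift B] * B))]))
  => [B /S_bin||p q [c Hc] [d Hd]|c m a B BS hB mBw] /=.
- exact: lattice_binomial_homogeneous.
- exists (fun=> 0); rewrite big1 ?subr0; first exact: ideal_span0.
  by move=> B _; rewrite scale0r.
- exists (fun B => c B + d B); under eq_bigr do rewrite scalerDl.
  by rewrite big_split opprD addrACA; apply: ideal_spanD.
have [wa|wa] := pselect (fiber_le L w a); last first.
  exists (fun=> 0); rewrite big1 => [|? _]; last by rewrite scale0r.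
  rewrite subr0; apply/ideal_spanZ/ideal_spanM.
  have [u [v [uv congr_uv BE]]] := S_bin _ BS.
  apply: ideal_span_gen; exists u, v; split=> // wu; apply: wa.
  apply: fiber_le_cong wu.
  apply: homogeneous_unique (lattice_binomial_neq0 (S_bin _ BS)) _ hB.
  by rewrite BE; apply: homogeneous_binomial.
have BT : B \in T by apply: S_T hB _ wa => //; exists m.
exists (fun B' => if B' == B then c else 0).
rewrite (bigD1_seq B) //= eqxx big1 ?addr0 => [|B' /negbTE ->]; last first.
  by rewrite scale0r.
rewrite -scalerBr -mulrBl mulrC; apply/ideal_spanZ/ideal_spanM/ideal_span_gen.
have [a' [ha' lift_w _]] := liftP _ BT.
have aa' := homogeneous_unique (lattice_binomial_neq0 (S_bin _ BS)) hB ha'.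
exists m, (lift B); split=> //.
  rewrite -(congruent_add2l _ a) ![(a + _)%MM]addmC.
  apply: congruent_trans mBw _; rewrite congruent_sym.
  by apply: congruent_trans lift_w; rewrite congruent_add2l.
(* From [d + w ~ m], [b + w ~ a] and [m + a ~ w] follows [d + b + w ~ 0]. *)
move=> [d dwm]; have [b bwa] := wa; apply: w0; exists (d + b)%MM.
rewrite -(congruent_add2l _ w) addm0.
apply: congruent_trans mBw; rewrite Monoid.mulmCA Monoid.mulmACA.
apply: (@congruent_trans _ _ (d + w + a)%MM); first by rewrite congruent_add2l.
by rewrite addmC [(m + _)%MM]addmC congruent_add2l.
Qed.

Definition in_class (k : fieldType) (n : nat) (L : zmodClosed 'rV[int]_n)
    (w : 'X_{1..n}) (B : {mpoly k[n]}) : Prop :=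
  exists a, [/\ homogeneous L a B, fiber_le L a w & fiber_le L w a].

Lemma size_class_le (k : fieldType) (n : nat)
    (L : zmodClosed 'rV[int]_n) (w : 'X_{1..n}) (S S' : {fset {mpoly k[n]}}) :
  minimal_generating_set L S -> minimal_generating_set L S' ->
  ~ fiber_le L w 0%MM ->
  (size [seq B <- enum_fset S | `[< in_class L w B >]] <=
   size [seq B <- enum_fset S' | `[< in_class L w B >]])%N.
Proof.
move=> minS minS' w0.
have /choice[lift Hlift] : forall B : {mpoly k[n]}, exists m : 'X_{1..n},
    in_class L w B -> exists a, [/\ homogeneous L a B,
      congruent L (m + a)%MM w & fiber_le L w a].
  move=> B; have [[a [hB [m maw] wa]]|] := pselect (in_class L w B).
    by exists m => _; exists a.
  by exists 0%MM.
have liftP (R : {fset {mpoly k[n]}}) B :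
    B \in [seq B <- enum_fset R | `[< in_class L w B >]] ->
    exists a, [/\ homogeneous L a B, congruent L (lift B + a)%MM w
                & fiber_le L w a].
  by rewrite mem_filter => /andP[/asboolP /Hlift].
have genP R R' : minimal_generating_set L R -> minimal_generating_set L R' ->
  forall B, B \in [seq B <- enum_fset R | `[< in_class L w B >]] ->
  exists c : {mpoly k[n]} -> k, not_above_ideal L w ('X_[lift B] * B -
    \sum_(B' <- [seq B <- enum_fset R' | `[< in_class L w B >]])
      c B' *: ('X_[lift B'] * B')).
  move=> minR minR' B BR; have [_ genR' _] := minR'.
  have [a [hB lift_w _]] := liftP _ _ BR.
  apply: (@lifted_generators_span _ _ _ _ R') => //.
  - by move=> B'; apply: minimal_generator_lattice_binomial.
  - exact/filter_uniq/fset_uniq.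
  - move=> B' a' B'R' hB' a'w wa'; rewrite mem_filter B'R' andbT.
    by apply/asboolP; exists a'.
  - exact: liftP.
  - exact/(homogeneous_cong lift_w)/homogeneousMX.
  - have [_ <- _] := minR; apply/ideal_spanM/ideal_span_gen => /=.
    by move: BR; rewrite mem_filter => /andP[].
apply: (@size_independent_le k _ _ (not_above_ideal L w) _ _
  (fun B => 'X_[lift B] * B) (fun B => 'X_[lift B] * B)).
- exact: ideal_span0.
- exact: ideal_spanD.
- exact: ideal_spanZ.
- exact/filter_uniq/fset_uniq.
- exact: genP.
- exact: genP.
move=> c; apply: (lifted_generators_independent minS) => //.
- exact/filter_uniq/fset_uniq.
- by move=> B; rewrite mem_filter => /andP[].
- exact: liftP.
Qed.

(** * Comparing the multisets *)

Lemma fiber_transport (n : nat) (L : zmodClosed 'rV[int]_n)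
    (a u v : 'X_{1..n}) :
  [set (a + x)%MM | x in fiber L u] `<=` fiber L v <->
  congruent L (a + u)%MM v.
Proof.
split=> [sub|auv _ [x xu <-]].
  by apply: sub; exists u => //; apply: congruent_refl.
by apply: congruent_trans auv; rewrite congruent_add2l.
Qed.

Lemma fiber_equivE (n : nat) (L : zmodClosed 'rV[int]_n) (u v : 'X_{1..n}) :
  fiber_equiv (fiber L u) (fiber L v) <-> fiber_le L u v /\ fiber_le L v u.
Proof.
split=> [[a [b [/fiber_transport auv /fiber_transport bvu]]]|[[a auv] [b bvu]]].
  by split; [exists a | exists b].
by exists a, b; split; apply/fiber_transport.
Qed.

Lemma fiber_class_fiber (n : nat) (L : zmodClosed 'rV[int]_n)
    (u v : 'X_{1..n}) :
  fiber_class L (fiber L u) (fiber L v) <-> fiber_le L u v /\ fiber_le L v u.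
Proof.
split=> [[_ /fiber_equivE]//|uv]; split; first by exists v.
exact/fiber_equivE.
Qed.

Lemma fiber_class_eq (n : nat) (L : zmodClosed 'rV[int]_n)
    (u v : 'X_{1..n}) :
  fiber_class L (fiber L u) = fiber_class L (fiber L v) <->
  fiber_le L u v /\ fiber_le L v u.
Proof.
split=> [uv|[uv vu]].
  apply/fiber_class_fiber; rewrite uv; apply/fiber_class_fiber.
  by split; exists 0%MM; rewrite add0m; apply: congruent_refl.
apply/seteqP; split=> _ [[x _ <-] /fiber_equivE[ax xa]];
  apply/fiber_class_fiber; split;
  by [apply: fiber_le_trans ax | apply: fiber_le_trans xa _].
Qed.

(** The multiplicity of [C] counts the generators in the class of [w], where
[w] is the degree of one generator of [S] with class [C]; if there is none, the
multiplicity is 0. *)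
Lemma count_fiber_class_le (k : fieldType) (n : nat)
    (L : zmodClosed 'rV[int]_n) (S S' : {fset {mpoly k[n]}})
    (C : set (set 'X_{1..n})) :
  minimal_generating_set L S -> minimal_generating_set L S' ->
  (fiber_class_mset L S C <= fiber_class_mset L S' C)%N.
Proof.
move=> minS minS'; rewrite !mset_seqE; set s := map _ _.
have [/mapP[B0]|/count_memPn -> //] := boolP (C \in s).
rewrite mem_filter => /andP[nB0 B0S] CE.
have LB0 := minimal_generator_lattice_binomial minS B0S.
have [w hB0] := lattice_binomial_homogeneous LB0.
rewrite (binomial_fiberE LB0 hB0) in nB0 CE.
have w0 : ~ fiber_le L w 0%MM.
  move=> w0; move/negP: nB0; apply; rewrite inE; apply/fiber_class_fiber.
  by split=> //; exists w; rewrite addm0; apply: congruent_refl.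
have countE R : minimal_generating_set L R ->
    count_mem C [seq fiber_class L (binomial_fiber L B) | B <- enum_fset R &
      binomial_fiber L B \notin fiber_class L (fiber L 0%MM)] =
    size [seq B <- enum_fset R | `[< in_class L w B >]].
  move=> minR; rewrite count_map count_filter size_filter.
  apply: eq_in_count => B BR /=.
  have LB := minimal_generator_lattice_binomial minR BR.
  have [a hB] := lattice_binomial_homogeneous LB.
  rewrite (binomial_fiberE LB hB); apply/andP/asboolP.
    by rewrite CE => -[/eqP/fiber_class_eq[aw wa] _]; exists a.
  move=> [b [hB' bw wb]].
  have ab := homogeneous_unique (lattice_binomial_neq0 LB) hB hB'.
  have aw : fiber_le L a w.
    by apply: fiber_le_trans bw; exists 0%MM; rewrite add0m.
  have wa : fiber_le L w a by apply: fiber_le_cong wb; rewrite congruent_sym.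
  split; first by apply/eqP; rewrite CE; apply/fiber_class_eq.
  apply/negP; rewrite inE => /fiber_class_fiber[_ a0].
  exact/w0/(fiber_le_trans wa).
by rewrite /s !countE //; apply: size_class_le.
Qed.

Theorem corollary4p16 (k : fieldType) (n : nat)
    (L : zmodClosed 'rV[int]_n) (S S' : {fset {mpoly k[n]}}) :
  minimal_generating_set L S -> minimal_generating_set L S' ->
  fiber_class_mset L S = fiber_class_mset L S'.
Proof.
move=> minS minS'; apply/msetP=> C; apply/eqP.
by rewrite eqn_leq !count_fiber_class_le.
Qed.
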